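(* Let $\varepsilon>0$ and $p\ge 1$. Let $R:\mathcal{X}\to[0,\infty)$ be a nonnegative function, which may depend on the sample $\widehat{\xi}_1,\dots,\widehat{\xi}_n$. Assume that for every $x\in\mathcal{X}$ the set $F(x,\Xi)=\{F(x,\xi):\xi\in\Xi\}$ is an interval and $\sup_{\xi\in\Xi}F(x,\xi)=\infty$. Then for every $x\in\mathcal{X}$, almost surely, $$\frac1n\sum_{i=1}^n F(x,\widehat{\xi}_i)+\varepsilon R(x)=\sup_{\mathbb{Q}\in\mathcal{B}_{\varepsilon R(x)}\left(F(x,\cdot)_{\#}\widehat{\mathbb{P}}_n\right)}\mathbb{E}_{\varsigma\sim\mathbb{Q}}[\varsigma].$$ Consequently, almost surely, the problem $$\min_{x\in\mathcal{X}}\ \frac1n\sum_{i=1}^n F(x,\widehat{\xi}_i)+\varepsilon R(x)$$ is equivalent to the problem $$\min_{x\in\mathcal{X}}\ \sup_{\mathbb{Q}\in\mathcal{B}_{\varepsilon R(x)}\left(F(x,\cdot)_{\#}\widehat{\mathbb{P}}_n\right)}\mathbb{E}_{\varsigma\sim\mathbb{Q}}[\varsigma].$$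
   Context: $\mathcal{X}\subseteq\mathbb{R}^k$ is nonempty, $\Xi\subseteq\mathbb{R}^d$, $\mathbb{P}$ is a probability distribution supported on $\Xi$, and $F:\mathcal{X}\times\Xi\to\mathbb{R}$ is such that $F(x,\cdot)$ is measurable for each $x$. $\widehat{\xi}_1,\dots,\widehat{\xi}_n$ are i.i.d. samples from $\mathbb{P}$ and $\widehat{\mathbb{P}}_n=\frac1n\sum_{i=1}^n\delta_{\widehat{\xi}_i}$ is the empirical distribution. For a measurable map $f$, $f_{\#}\mathbb{Q}$ is the push-forward of $\mathbb{Q}$ through $f$; thus $F(x,\cdot)_{\#}\widehat{\mathbb{P}}_n=\frac1n\sum_i\delta_{F(x,\widehat{\xi}_i)}$. For a probability measure $\mu$ on $\mathbb{R}$ and $r\ge 0$, $\mathcal{B}_r(\mu)=\{\mathbb{Q}: W_p(\mathbb{Q},\mu)\le r\}$ is the ball of probability measures on $\mathbb{R}$ with respect to the $p$-Wasserstein distance with ground cost $|\varsigma_1-\varsigma_2|$, i.e. $W_p(\mathbb{Q},\mu)=\big(\inf_\Pi\int|\varsigma_1-\varsigma_2|^p\,\Pi(d\varsigma_1,d\varsigma_2)\big)^{1/p}$, the infimum being over couplings $\Pi$ of $\mathbb{Q}$ and $\mu$. *)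

(* Defs.v *)
From HB Require Import structures.
From mathcomp Require Import all_boot all_order all_algebra.
From mathcomp Require Import all_classical all_reals all_analysis.
Import Order.TTheory GRing.Theory Num.Theory.
Import numFieldNormedType.Exports.

Set Implicit Arguments.
Unset Strict Implicit.
Unset Printing Implicit Defensive.

Local Open Scope classical_set_scope.
Local Open Scope ring_scope.

(* R^d with its Borel sigma-algebra. *)
Notation borel_rV R d := (g_sigma_algebraType (@open 'rV[R]_d)).

Section iid_samples.
Context (dO dT : measure_display) (Omega : measurableType dO)
  (T : measurableType dT) (R : realType).

Definition mutually_independent (Pr : probability Omega R) (n : nat)
    (xi : 'I_n -> {mfun Omega >-> T}) : Prop :=
  forall (J : {set 'I_n}) (B : 'I_n -> set T),
    (forall i, measurable (B i)) ->
    Pr (\bigcap_(i in [set i | i \in J]) (xi i @^-1` B i)) =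
    (\prod_(i in J) Pr (xi i @^-1` B i))%E.

Definition iid_from (Pr : probability Omega R) (P : probability T R) (n : nat)
    (xi : 'I_n -> {mfun Omega >-> T}) : Prop :=
  (forall i (B : set T), measurable B -> distribution Pr (xi i) B = P B) /\
  mutually_independent Pr xi.

End iid_samples.

(* Given as a set function on all subsets: it can then be pushed forward through
   a map that is only meaningful (and measurable) on a subset of T. *)
Definition empirical (dT : measure_display) (T : measurableType dT)
    (R : realType) (n : nat) (s : 'I_n -> T) : set T -> \bar R :=
  fun A => ((n%:R^-1)%:E * \sum_(i < n) \d_(s i) A)%E.

Section wasserstein.
Context (R : realType).

Definition couplings (Q mu : set (measurableTypeR R) -> \bar R) :
    set (probability (measurableTypeR R * measurableTypeR R)%type R) :=
  [set Pi | forall A : set (measurableTypeR R), measurable A ->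
     pushforward Pi fst A = Q A /\ pushforward Pi snd A = mu A].

Definition wasserstein (p : R) (Q mu : set (measurableTypeR R) -> \bar R) :
    \bar R :=
  (ereal_inf [set (\int[Pi]_z (`|z.1 - z.2| `^ p)%:E)%E
             | Pi in couplings Q mu] `^ p^-1)%E.

Definition wasserstein_ball (p r : R)
    (mu : set (measurableTypeR R) -> \bar R) :
    set (probability (measurableTypeR R) R) :=
  [set Q | (wasserstein p Q mu <= r%:E)%E].

End wasserstein.

Section minimization.
Context (T : Type) (R : realType).

Definition optimal_value (X : set T) (f : T -> \bar R) : \bar R :=
  ereal_inf (f @` X).

Definition minimizers (X : set T) (f : T -> \bar R) : set T :=
  [set x | X x /\ forall y, X y -> (f x <= f y)%E].

Definition equivalent_min (X : set T) (f g : T -> \bar R) : Prop :=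
  optimal_value X f = optimal_value X g /\ minimizers X f = minimizers X g.

End minimization.

Section objectives.
Context (R : realType) (k d n : nat) (F : 'rV[R]_k -> borel_rV R d -> R).

Definition regularized_risk (eps : R) (Reg : 'rV[R]_k -> R)
    (s : 'I_n -> borel_rV R d) (x : 'rV[R]_k) : \bar R :=
  (n%:R^-1 * (\sum_(i < n) F x (s i)) + eps * Reg x)%:E.

Definition robust_risk (p eps : R) (Reg : 'rV[R]_k -> R)
    (s : 'I_n -> borel_rV R d) (x : 'rV[R]_k) : \bar R :=
  ereal_sup [set ('E_Q[id])%E
    | Q in wasserstein_ball p (eps * Reg x)
             (pushforward (empirical R s) (F x : _ -> measurableTypeR R))].

End objectives.

(* Main.v *)
(* If [Pi] couples [Q] and [nu], then [E_Q - E_nu] is the integral of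
   [z.1 - z.2], so by Jensen it is at most the [p]-th root of the transport cost
   of [Pi]; hence the expectation grows by at most [r] on the ball of radius [r].
   The bound is attained by translating [nu] by [r], which is always allowed:
   members of the ball need not be supported on [F x @` Xi], so the
   almost-sure event is only that all samples lie in [Xi] (where [Reg] is
   nonnegative), and it does not depend on [x]. *)
Require Import Defs.
From HB Require Import structures.
From mathcomp Require Import all_boot all_order all_algebra.
From mathcomp Require Import all_classical all_reals all_analysis.
From mathcomp Require Import measurable_realfun.
Import Order.TTheory GRing.Theory Num.Theory.
Import numFieldNormedType.Exports.

Set Implicit Arguments.
Unset Strict Implicit.
Unset Printing Implicit Defensive.

Local Open Scope classical_set_scope.
Local Open Scope ring_scope.

(** * Comparison of norms on a probability space *)

(** Hölder's inequality for [f] and the constant 1, whose norm is 1 because [P] has total mass 1.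
    The case [p = 1] is split off so that the conjugate exponent [(1 - p^-1)^-1] is finite. *)
Lemma Lnorm1_le_Lnorm d (T : measurableType d) (R : realType)
    (P : probability T R) (f : T -> R) (p : R) :
    1 <= p -> measurable_fun [set: T] f ->
  ('N[P]_1[EFin \o f] <= 'N[P]_p%:E[EFin \o f])%E.
Proof.
rewrite le_eqVlt => /predU1P[<- //|p1] mf.
have p0 : 0 < p := lt_trans ltr01 p1.
have q0 : 0 < (1 - p^-1)^-1 by rewrite invr_gt0 subr_gt0 invf_lt1.
have := @hoelder _ _ _ P f (cst 1) p (1 - p^-1)^-1 mf (measurable_cst _) p0 q0.
rewrite invrK subrKC => /(_ erefl).
rewrite (_ : f \* cst 1 = f); last by apply/funext => x /=; rewrite mulr1.
by rewrite Lnorm_cst1 [X in (X `^ _)%E]probability_setT poweR1r mule1.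
Qed.

(** * Marginals of a coupling and the upper bound on the expectation *)

Section coupling.
Context (R : realType).
Local Open Scope ereal_scope.
Implicit Types Q nu : probability (measurableTypeR R) R.

Section law.
Context d (T : measurableType d) (P : probability T R)
  (phi : T -> measurableTypeR R) (nu : probability (measurableTypeR R) R).
Hypotheses (mphi : measurable_fun [set: T] phi)
  (phi_law : forall A, measurable A -> pushforward P phi A = nu A).
(** Bundling [phi] with its measurability turns its push-forward into a measure, which can then be
    compared with [nu] under the integral. *)
Let phi_mfun : {mfun T >-> measurableTypeR R} :=
  HB.pack phi (isMeasurableFun.Build _ _ _ _ phi mphi).

Let integral_law (f : measurableTypeR R -> \bar R) :
  \int[nu]_x f x = \int[pushforward P phi]_x f x.
Proof.
by apply: (eq_measure_integral (pushforward P phi_mfun)) => A mA _;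
  exact/esym/phi_law.
Qed.

Lemma integrable_law :
    nu.-integrable [set: measurableTypeR R] (EFin \o id) ->
  P.-integrable [set: T] (EFin \o phi).
Proof.
move=> /integrableP[_ fin]; apply/integrableP; split.
  exact/measurable_EFinP.
move: fin; rewrite integral_law ge0_integral_pushforward//.
by apply: measurableT_comp => //; exact/measurable_EFinP.
Qed.

(** Change of variables; it serves for both marginals of a coupling and for the translated law. *)
Lemma expectation_law :
  P.-integrable [set: T] (EFin \o phi) -> 'E_nu[id] = 'E_P[phi].
Proof.
by move=> iphi; rewrite unlock integral_law integral_pushforward.
Qed.

End law.

Lemma expectation_coupling_le Q nu Pi (p : R) : (1 <= p)%R ->
    nu.-integrable [set: measurableTypeR R] (EFin \o id) ->
    couplings Q nu Pi ->
  'E_Q[id] <= 'E_nu[id] + (\int[Pi]_z (`|z.1 - z.2| `^ p)%:E) `^ p^-1.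
Proof.
move=> p1 inu cPi.
pose D (z : measurableTypeR R * measurableTypeR R) : R := (z.1 - z.2)%R.
have mD : measurable_fun setT D.
  by apply: measurable_funB; [exact: measurable_fst|exact: measurable_snd].
have i2 := integrable_law measurable_snd (fun A mA => (cPi A mA).2) inu.
have -> : (\int[Pi]_z (`|z.1 - z.2| `^ p)%:E) `^ p^-1 = 'N[Pi]_p%:E[EFin \o D].
  by rewrite unlock.
rewrite (expectation_law measurable_snd (fun A mA => (cPi A mA).2) i2).
have E2 : 'E_Pi[snd] \is a fin_num.
  by rewrite unlock; apply: integrable_fin_num.
(* An infinite cost makes the bound trivial, since ['E_Pi[snd]] is finite. Otherwise [D] is
   integrable by the comparison of norms, hence so is [fst], the sum of [snd] and [D]; this is where
   the integrability of the first marginal comes from. *)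
set N := (X in _ + X); have [->|Doo] := eqVneq N +oo.
  by case/fin_numP : E2 => EN _; rewrite addey ?leey.
have /le_lt_trans NDoo := Lnorm1_le_Lnorm Pi p1 mD.
have iD : Pi.-integrable setT (EFin \o D).
  apply/integrableP; split; first exact/measurable_EFinP.
  by rewrite -(Lnorm1 Pi (EFin \o D)) NDoo// ltey.
have i1 : Pi.-integrable setT (EFin \o fst).
  rewrite (_ : EFin \o fst = (EFin \o snd) \+ (EFin \o D)).
    exact: integrableD.
  by apply/funext => z /=; rewrite -EFinD addrC subrK.
rewrite (expectation_law measurable_fst (fun A mA => (cPi A mA).1) i1).
rewrite (_ : 'E_Pi[fst] = 'E_Pi[snd] + \int[Pi]_z (D z)%:E); last first.
  rewrite unlock -integralD//; apply: eq_integral => z _.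
  by rewrite /D -EFinD addrC subrK.
(* The integral of [D] is at most its absolute value, hence at most the 1-norm of [D], hence at most
   the [p]-norm. *)
rewrite leeD2l//; apply: le_trans (Lnorm1_le_Lnorm Pi p1 mD).
rewrite Lnorm1; apply: le_trans (le_abse_integral _ _ _); rewrite ?lee_abs//.
exact/measurable_EFinP.
Qed.

End coupling.

(** * Largest expectation over a Wasserstein ball *)

Section wasserstein_ball_expectation.
Context (R : realType).
Local Open Scope ereal_scope.
Implicit Types Q nu : probability (measurableTypeR R) R.

(** Couplings test their marginals on measurable sets only. This lets a bare set function be
    replaced as centre by a genuine probability. *)
Lemma wasserstein_ball_congr (p r : R)
    (mu nu : set (measurableTypeR R) -> \bar R) :
    (forall A, measurable A -> mu A = nu A) ->
  wasserstein_ball p r mu = wasserstein_ball p r nu.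
Proof.
move=> munu; apply/seteqP; split => Q;
  rewrite /wasserstein_ball /wasserstein /=;
  rewrite (_ : couplings Q mu = couplings Q nu)//;
  by apply/seteqP; split => Pi cPi A mA; have [-> ->] := cPi A mA;
     rewrite munu.
Qed.

(** No optimal coupling is assumed to exist, so the radius is enlarged by an arbitrary [e > 0], and
    some coupling then costs at most the [p]-th power of [r + e]. *)
Lemma expectation_wasserstein_ball_le (p r : R) Q nu :
    (1 <= p)%R -> (0 <= r)%R ->
    nu.-integrable [set: measurableTypeR R] (EFin \o id) ->
    wasserstein_ball p r nu Q ->
  'E_Q[id] <= 'E_nu[id] + r%:E.
Proof.
move=> p1 r0 inu WQ; apply/lee_addgt0Pr => e e0.
have p0 : (0 < p)%R := lt_le_trans ltr01 p1.
have re0 : (0 <= r + e)%R by rewrite addr_ge0// ltW.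
suff [Pi cPi Pire] : exists2 Pi, couplings Q nu Pi &
    \int[Pi]_z (`|z.1 - z.2| `^ p)%:E <= ((r + e) `^ p)%:E.
  apply: le_trans (expectation_coupling_le p1 inu cPi) _.
  rewrite -addeA leeD2l// -EFinD.
  rewrite -[leRHS](_ : ((r + e) `^ p)%:E `^ p^-1 = _); last first.
    by rewrite poweR_EFin -powRrM divff ?gt_eqF// powRr1.
  apply: gt0_ler_poweR => //; rewrite ?invr_ge0 ?ltW// in_itv/= leey andbT.
    by apply: integral_ge0 => z _; rewrite lee_fin powR_ge0.
  by rewrite lee_fin powR_ge0.
(* Raising to the power [p] undoes the root and leaves the infimum itself; the strict inequality
   then yields an actual coupling. *)
have infre : wasserstein p Q nu `^ p < ((r + e) `^ p)%:E.
  apply: (@le_lt_trans _ _ (r%:E `^ p)).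
    apply: gt0_ler_poweR => //;
      rewrite ?in_itv/= ?leey ?andbT ?lee_fin// ?(ltW p0)//.
    exact: poweR_ge0.
  by rewrite poweR_EFin lte_fin gt0_ltr_powR// ?nnegrE// ltrDl.
move: infre; rewrite -poweRrM mulVf ?gt_eqF// poweRe1; last first.
  apply/ereal_infP => _ [Pi _ <-].
  by apply: integral_ge0 => z _; rewrite lee_fin powR_ge0.
move=> /ereal_inf_lt[_ [Pi cPi <-]] /ltW ?; by exists Pi.
Qed.

Section shift.
Variables (nu : probability (measurableTypeR R) R) (r : R).

Let shift (a : measurableTypeR R) : measurableTypeR R := (a + r)%R.
Let shift_graph (a : measurableTypeR R) := (shift a, a).

Let measurable_shift : measurable_fun setT shift.
Proof. by apply: measurable_funD. Qed.

Let measurable_shift_graph : measurable_fun setT shift_graph.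
Proof. by apply: measurable_fun_pair. Qed.

(** The witness is the law of [a + r] for [a] distributed as [nu]. It is coupled to [nu] by the law
    of the pair [(a + r, a)], whose cost is the constant [r ^ p]. *)
Lemma wasserstein_ball_shift (p : R) : (0 < p)%R -> (0 <= r)%R ->
    nu.-integrable [set: measurableTypeR R] (EFin \o id) ->
  exists2 Q, wasserstein_ball p r nu Q & 'E_Q[id] = 'E_nu[id] + r%:E.
Proof.
move=> p0 r0 inu.
pose S : {mfun measurableTypeR R >-> measurableTypeR R} :=
  HB.pack shift (isMeasurableFun.Build _ _ _ _ shift measurable_shift).
pose G : {mfun measurableTypeR R >->
    (measurableTypeR R * measurableTypeR R)%type} :=
  HB.pack shift_graph
    (isMeasurableFun.Build _ _ _ _ shift_graph measurable_shift_graph).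
exists (distribution nu S).
  rewrite /wasserstein_ball /wasserstein/=.
  rewrite -[leRHS](_ : (r `^ p)%:E `^ p^-1 = _); last first.
    by rewrite poweR_EFin -powRrM divff ?gt_eqF// powRr1.
  apply: gt0_ler_poweR => //;
    rewrite ?in_itv/= ?leey ?andbT ?lee_fin ?powR_ge0 ?invr_ge0 ?(ltW p0)//.
    apply/ereal_infP => _ [Pi _ <-].
    by apply: integral_ge0 => z _; rewrite lee_fin powR_ge0.
  apply: ge_ereal_inf; eexists; first by exists (distribution nu G).
  rewrite ge0_integral_distribution//=.
    under eq_integral do rewrite /shift addrAC subrr add0r ger0_norm//.
    by rewrite integral_cst// [X in _ * X]probability_setT mule1.
  apply/measurable_EFinP.
  apply: (@measurableT_comp _ _ _ _ _ _ (@powR R ^~ p)) => //.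
  apply: measurableT_comp => //.
  by apply: measurable_funB; [exact: measurable_fst|exact: measurable_snd].
have iS : nu.-integrable setT (EFin \o S).
  rewrite (_ : EFin \o S = (EFin \o id) \+ cst r%:E)//.
  by apply: integrableD => //; exact: finite_measure_integrable_cst.
rewrite (@expectation_law _ _ _ nu S _ measurable_shift)//.
rewrite unlock (_ : (fun w => (S w)%:E) = (EFin \o id) \+ cst r%:E)//.
rewrite integralD//; last exact: finite_measure_integrable_cst.
by rewrite integral_cst// [X in _ * X]probability_setT mule1.
Qed.

End shift.

Lemma ereal_sup_wasserstein_ball (p r : R) nu : (1 <= p)%R -> (0 <= r)%R ->
    nu.-integrable [set: measurableTypeR R] (EFin \o id) ->
  ereal_sup [set 'E_Q[id] | Q in wasserstein_ball p r nu] = 'E_nu[id] + r%:E.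
Proof.
move=> p1 r0 inu; apply/eqP; rewrite eq_le; apply/andP; split.
  apply: ge_ereal_sup => _ [Q WQ <-].
  exact: expectation_wasserstein_ball_le WQ.
have [Q WQ <-] := wasserstein_ball_shift (lt_le_trans ltr01 p1) r0 inu.
by apply: ereal_sup_ubound; exists Q.
Qed.

End wasserstein_ball_expectation.

(** * The empirical distribution as a probability measure *)

Section empirical_probability.
Context d (T : measurableType d) (R : realType) (m : nat) (s : 'I_m.+1 -> T).
Local Open Scope ereal_scope.

Let mass : {nonneg R} := ((m.+1%:R^-1)%:nng)%R.
(** [msum] sums a family indexed by [nat]; [inord] extends the sample to all indices, and only those
    below [m.+1] enter the sum. *)
Let diracs (i : nat) : {measure set T -> \bar R} := dirac (s (inord i)).

Definition empirical_measure : set T -> \bar R :=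
  mscale mass (msum diracs m.+1).

HB.instance Definition _ := Measure.on empirical_measure.

Lemma empirical_measureE A : empirical_measure A = empirical R s A.
Proof.
rewrite /empirical_measure /mscale /msum /empirical /=; congr *%E.
by apply: eq_bigr => i _; rewrite /diracs inord_val.
Qed.

Let empirical_measure_setT : empirical_measure setT = 1.
Proof.
rewrite empirical_measureE /empirical.
under eq_bigr do rewrite diracT.
by rewrite sumEFin sumr_const card_ord -EFinM mulVf// pnatr_eq0.
Qed.

HB.instance Definition _ :=
  Measure_isProbability.Build _ _ _ empirical_measure empirical_measure_setT.

Lemma ge0_integral_empirical (f : T -> R) :
    measurable_fun setT f -> (forall x, (0 <= f x)%R) ->
  \int[empirical_measure]_x (f x)%:E = (m.+1%:R^-1 * (\sum_i f (s i)))%R%:E.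
Proof.
move=> mf f0; rewrite ge0_integral_mscale//; last 2 first.
- exact/measurable_EFinP.
- by move=> x _; rewrite lee_fin.
rewrite ge0_integral_measure_sum//; last 2 first.
- by move=> x _; rewrite lee_fin.
- exact/measurable_EFinP.
rewrite EFinM -sumEFin; congr *%E; apply: eq_bigr => i _.
by rewrite integral_dirac ?diracT ?mul1e ?inord_val//; exact/measurable_EFinP.
Qed.

Lemma integrable_empirical (f : T -> R) :
  measurable_fun setT f -> empirical_measure.-integrable setT (EFin \o f).
Proof.
move=> mf; apply/integrableP; split; first exact/measurable_EFinP.
rewrite (ge0_integral_empirical (f := Num.norm \o f)) ?ltry//.
  exact: measurableT_comp.
by move=> x; exact: normr_ge0.
Qed.

(** The formula for nonnegative functions is applied to the positive and negative parts; both
    integrals are finite, so they can be subtracted. *)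
Lemma expectation_empirical (f : T -> R) : measurable_fun setT f ->
  'E_empirical_measure[f] = (m.+1%:R^-1 * (\sum_i f (s i)))%R%:E.
Proof.
move=> mf; rewrite unlock integralE.
rewrite (funerpos f) (funerneg f).
rewrite !ge0_integral_empirical//; last 2 first.
- exact: measurable_funrneg.
- exact: measurable_funrpos.
rewrite -EFinB -mulrBr -sumrB; congr (_ * _)%:E; apply: eq_bigr => i _.
by rewrite -[in RHS](funrposBneg f).
Qed.

End empirical_probability.

(** * Equality of the two objectives on the event that all samples lie in the support *)

Lemma equivalent_min_eq (T : Type) (R : realType) (X : set T)
    (f g : T -> \bar R) :
  (forall x, X x -> f x = g x) -> equivalent_min X f g.
Proof.
move=> fg; split; first by congr ereal_inf; exact: eq_imagel.
apply/seteqP; split => x [Xx xmin]; split => // y Xy.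
  by rewrite -!fg//; exact: xmin.
by rewrite !fg//; exact: xmin.
Qed.

Lemma regularized_risk_eq_robust_risk (R : realType) (k d n : nat)
    (F : 'rV[R]_k -> borel_rV R d -> R) (p eps : R) (Reg : 'rV[R]_k -> R)
    (s : 'I_n -> borel_rV R d) (x : 'rV[R]_k) :
    (0 < n)%N -> 1 <= p -> 0 <= eps * Reg x ->
  regularized_risk F eps Reg s x = robust_risk F p eps Reg s x.
Proof.
case: n s => // n s _ p1 r0.
pose a i : measurableTypeR R := F x (s i).
rewrite /regularized_risk /robust_risk.
(* Pushing a Dirac mass at [s i] through [F x] gives the Dirac mass at [a i], so the centre of the
   ball is the empirical measure of the values [a]. *)
rewrite (@wasserstein_ball_congr _ _ _ _ (empirical_measure R a)); last first.
  by move=> A _; rewrite empirical_measureE.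
rewrite ereal_sup_wasserstein_ball//; last exact: integrable_empirical.
by rewrite expectation_empirical// -EFinD.
Qed.

(** A measurable [P]-null set [N] covers the complement of [Xi]. Its preimage under each [xi i] is
    null because [xi i] has law [P], and there are finitely many indices. *)
Lemma ae_samples_in (R : realType) dO dT (Omega : measurableType dO)
    (T : measurableType dT) (Pr : probability Omega R) (P : probability T R)
    (n : nat) (xi : 'I_n -> {mfun Omega >-> T}) (Xi : set T) :
    (forall i B, measurable B -> distribution Pr (xi i) B = P B) ->
    P.-negligible (~` Xi) ->
  {ae Pr, forall w, forall i, Xi (xi i w)}.
Proof.
move=> xiP [N [mN N0 XiN]]; apply: filter_forall => i.
exists (xi i @^-1` N); split; [exact: measurable_funPTI| |].
  by rewrite -N0 -(xiP i).
by move=> w; exact: XiN.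
Qed.

Theorem theorem3p1 (R : realType) (k d n : nat) (n_gt0 : (0 < n)%N)
  (X : set 'rV[R]_k) (X_neq0 : X !=set0)
  (Xi : set (borel_rV R d))
  (P : probability (borel_rV R d) R) (P_supp : P.-negligible (~` Xi))
  (F : 'rV[R]_k -> borel_rV R d -> R)
  (* F x is measurable on Xi for the trace sigma-algebra *)
  (F_meas : forall x, X x ->
     preimage_set_system Xi (F x) (@measurable _ (measurableTypeR R))
       `<=` strace (@measurable _ (borel_rV R d)) Xi)
  (dO : measure_display) (Omega : measurableType dO)
  (Pr : probability Omega R)
  (xi : 'I_n -> {mfun Omega >-> borel_rV R d}) (xi_iid : iid_from Pr P xi)
  (eps p : R) (eps_gt0 : 0 < eps) (p_ge1 : 1 <= p)
  (Reg : ('I_n -> borel_rV R d) -> 'rV[R]_k -> R)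
  (Reg_ge0 : forall s, (forall i, Xi (s i)) -> forall x, X x -> 0 <= Reg s x)
  (F_itv : forall x, X x -> is_interval [set F x z | z in Xi])
  (F_sup : forall x, X x -> ereal_sup [set (F x z)%:E | z in Xi] = +oo%E) :
  (forall x, X x -> {ae Pr, forall w,
     regularized_risk F eps (Reg (fun i => xi i w)) (fun i => xi i w) x =
     robust_risk F p eps (Reg (fun i => xi i w)) (fun i => xi i w) x}) /\
  {ae Pr, forall w,
     equivalent_min X
       (regularized_risk F eps (Reg (fun i => xi i w)) (fun i => xi i w))
       (robust_risk F p eps (Reg (fun i => xi i w)) (fun i => xi i w))}.
Proof.
have samples := ae_samples_in xi_iid.1 P_supp.
have risk_eq w x : (forall i, Xi (xi i w)) -> X x ->
    regularized_risk F eps (Reg (fun i => xi i w)) (fun i => xi i w) x =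
    robust_risk F p eps (Reg (fun i => xi i w)) (fun i => xi i w) x.
  move=> Xiw Xx; apply: regularized_risk_eq_robust_risk => //.
  by rewrite mulr_ge0 ?(ltW eps_gt0)// Reg_ge0.
(* One event serves both claims: on it the objectives agree at all points of [X] simultaneously,
   however large [X] is. *)
split=> [x Xx|]; apply: filterS samples => w Xiw; first exact: risk_eq.
by apply: equivalent_min_eq => x Xx; exact: risk_eq.
Qed.
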